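(* Let $p$ be a prime, $\alpha\ge 1$ an integer and $N=p^\alpha$. Let $D\subset\mathbb{Z}_{\ge 0}$ be a nonempty finite set whose elements lie in pairwise different residue classes modulo $N$, let $\mu=\mu_{N,D}$ be the associated Cantor measure, and let $T=\{t>0:\Phi_{p^t}\mid P_D\}$, where $P_D(x)=\sum_{d\in D}x^d$. Let $\Lambda\subset\mathbb{Z}$. If $E(\Lambda)$ is an orthogonal set in $L^2(\mu)$, then for every $n\geq 0$ and every finite sequence of integers $(d_j)_{j=0}^{n-1}$ with $0\leq d_j<N$, we have $$|\{d_n(\lambda):\lambda\in\Lambda_n(d_0,\dots,d_{n-1})\}|\leq p^{|T|}.$$
   Context: Cantor measure: $\mu=\mu_{N,D}$ is the unique Borel probability measure on $\mathbb{R}$ satisfying $\mu=\frac{1}{|D|}\sum_{d\in D}\mu\circ\phi_d^{-1}$, where $\phi_d(x)=N^{-1}(x+d)$. Cyclotomic polynomials: $\Phi_n$ denotes the $n$-th cyclotomic polynomial. $T$ is the set of positive integers $t$ such that $\Phi_{p^t}$ divides $P_D$. Exponentials: $e_\lambda(x)=e^{2\pi i\lambda x}$ and $E(\Lambda)=\{e_\lambda:\lambda\in\Lambda\}$. ''$E(\Lambda)$ is orthogonal in $L^2(\mu)$'' means $\int e_\lambda\overline{e_{\lambda'}}\,d\mu=0$ for all $\lambda\ne\lambda'$ in $\Lambda$. Base-$N$ digits: for $k\in\mathbb{Z}$ the sequence $(d_n(k))_{n\ge0}$ with $0\le d_n(k)<N$ is defined by $k_0=k$ and $k_n=d_n(k)+Nk_{n+1}$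 with $k_{n+1}\in\mathbb{Z}$, for $n\ge 0$. (It is eventually $0$ if $k\ge 0$ and eventually $N-1$ if $k<0$.) For $\Lambda\subset\mathbb{Z}$, $n\ge0$ and integers $0\le d_0,\dots,d_{n-1}<N$: $\Lambda_n(d_0,\dots,d_{n-1})=\{\lambda\in\Lambda: d_j(\lambda)=d_j\ \text{for all}\ 0\le j<n\}$; for $n=0$, $\Lambda_0=\Lambda$. $|A|$ is the number of elements of a finite set $A$. *)

(* Defs.v *)
From mathcomp Require Import all_boot all_order all_algebra all_field.
From mathcomp Require Import finmap complex.
From mathcomp Require Import all_classical all_reals all_analysis.

Set Implicit Arguments.
Unset Strict Implicit.
Unset Printing Implicit Defensive.

Import Order.TTheory GRing.Theory Num.Theory.

Local Open Scope classical_set_scope.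
Local Open Scope ring_scope.
Local Open Scope complex_scope.

Section CantorMeasure.
Context {R : realType}.

Definition contraction (N d : nat) (x : R) : R := N%:R^-1 * (x + d%:R).

(* The Borel probability measures satisfying
   mu = 1/|D| \sum_(d in D) mu \o phi_d^-1; for N > 1 and D nonempty, there is
   exactly one. *)
Definition cantor_measure (N : nat) (D : {fset nat})
    (mu : probability (measurableTypeR R) R) : Prop :=
  forall A : set (measurableTypeR R), measurable A ->
    mu A = (((#|` D|%:R)^-1)%:E *
            \sum_(d <- D) mu (contraction N d @^-1` A))%E.

Definition expfun (lambda x : R) : R[i] :=
  cos (2 * pi * lambda * x) +i* sin (2 * pi * lambda * x).

(* The library has no complex-valued Lebesgue integral: real and imaginary
   parts are integrated separately. *)
Definition Cintegral (mu : probability (measurableTypeR R) R) (f : R -> R[i]) :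
    R[i] :=
  (\int[mu]_x complex.Re (f x)) +i* (\int[mu]_x complex.Im (f x)).

(* Orthogonality in L^2(mu) of the exponentials with frequencies in Lam. *)
Definition orthogonal_exponentials (mu : probability (measurableTypeR R) R)
    (Lam : set int) : Prop :=
  forall l l' : int, Lam l -> Lam l' -> l != l' ->
    Cintegral mu (fun x => expfun l%:~R x * (expfun l'%:~R x)^*) = 0.

End CantorMeasure.

Definition mask_poly (D : {fset nat}) : {poly int} := \sum_(d <- D) 'X^d.

(* Over int, %| is pseudo-divisibility; as cyclotomic polynomials are monic it
   is divisibility in Z[X] here (Pdiv.IdomainMonic.dvdpP). *)
Definition cyclotomic_exponents (p : nat) (D : {fset nat}) : set nat :=
  [set t | (0 < t)%N /\ 'Phi_(p ^ t)%N %| mask_poly D].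

(* Floor division by N: k_0 = k and k_n = d_n(k) + N k_{n+1}. *)
Fixpoint digit_tail (N : nat) (k : int) (n : nat) : int :=
  if n is m.+1 then (digit_tail N k m %/ N%:Z)%Z else k.

Definition digit (N n : nat) (k : int) : int := (digit_tail N k n %% N%:Z)%Z.

Definition digit_cylinder (N : nat) (Lam : set int) (n : nat)
    (d : 'I_n -> int) : set int :=
  [set l | Lam l /\ forall j : 'I_n, digit N j l = d j].

Lemma digit_tailE N k n :
  digit_tail N k n = digit N n k + N%:Z * digit_tail N k n.+1.
Proof. by rewrite /digit /= addrC mulrC -divz_eq. Qed.

Lemma digit_bounds N n k : (0 < N)%N -> 0 <= digit N n k < N%:Z.
Proof.
move=> N0; have NZ0 : N%:Z != 0 by rewrite -lt0n.
by rewrite modz_ge0 //= (ltz_mod _ NZ0).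
Qed.

(* fset_set is only meaningful on finite sets: the two sets whose cardinals are
   compared are indeed finite. *)
Lemma finite_cyclotomic_exponents p (D : {fset nat}) :
  prime p -> D != fset0 -> finite_set (cyclotomic_exponents p D).
Proof.
move=> pP D0; have P0 : mask_poly D != 0.
  apply/eqP => /(congr1 (fun q => q.[1])); rewrite horner0 /mask_poly.
  rewrite horner_sum; under eq_bigr do rewrite hornerXn expr1n.
  rewrite big_const_seq count_predT iter_addr_0 => /eqP.
  by rewrite pnatr_eq0 cardfs_eq0 (negPf D0).
apply: (sub_finite_set _ (finite_II (size (mask_poly D)).+1)) => t /= [t0 dP].
have := dvdp_leq P0 dP; rewrite size_Cyclotomic => le.
rewrite ltnS; apply: leq_trans (ltnW le).
rewrite totient_pfactor//; case: t t0 {dP le} => // t _ /=.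
apply: (@leq_trans (p ^ t)); first exact: (ltn_expl _ (prime_gt1 pP)).
by rewrite leq_pmull// -ltnS prednK ?prime_gt0// prime_gt1.
Qed.

Lemma finite_digits N n (A : set int) :
  (0 < N)%N -> finite_set [set digit N n l | l in A].
Proof.
move=> N0; apply: (sub_finite_set _ (finite_image Posz (finite_II N))).
move=> _ [l _ <-] /=; have /andP[] := digit_bounds n l N0.
by case: (digit N n l) => // m _ mN; exists m.
Qed.

(* Main.v *)
Require Import Defs.
From mathcomp Require Import all_boot all_order all_algebra all_field.
From mathcomp Require Import finmap complex.
From mathcomp Require Import all_classical all_reals all_analysis.
From mathcomp Require Import measurable_realfun ring lra.

(* Let F(a) be the integral of e_a against mu and e(x) = exp(2 pi i x).
   Self-similarity gives F(a) = P_D(e(a/N)) F(a/N) / |D|, and F(a/N^k) -> 1, so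
   F(a) = 0 forces P_D(e(a/N^k)) = 0 for some k > 0. When a = m is a positive
   integer, e(m/N^k) is a root of unity of order p^t with
   t = alpha k - v_p(m), so that t is in T. Now if two elements of Lambda have
   the same digits before the n-th one, and n-th digits a > b, then
   v_p of their difference is alpha n + r with r = v_p(a - b) < alpha, hence
   r = - t modulo alpha for some t in T. As a and b differ in their base-p digit
   of rank r, the n-th digit is determined by |T| digits in base p. *)

Set Implicit Arguments.
Unset Strict Implicit.
Unset Printing Implicit Defensive.

Import Order.TTheory GRing.Theory Num.Theory.
Import numFieldNormedType.Exports.

Local Open Scope classical_set_scope.
Local Open Scope ring_scope.

(** * Cyclotomic divisibility and a remark on base-p digits *)

Local Notation pZto F := (map_poly (intr : int -> F)).

(** ['X^n - 1] is the product of the ['Phi_d] over the divisors d of n. If the factor vanishing at z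
    has index d, then z^d = 1, so n divides d. *)
Lemma root_Cyclotomic (F : numFieldType) n (z : F) :
  n.-primitive_root z -> root (pZto F 'Phi_n) z.
Proof.
move=> zP; have n0 := prim_order_gt0 zP.
have : root (pZto F ('X^n - 1)) z.
  by rewrite rmorphB rmorph1 /= map_polyXn rootE !hornerE prim_expr_order// subrr.
rewrite -prod_Cyclotomic// rmorph_prod /= rootE horner_prod prodf_seq_eq0.
case/hasP => d; rewrite -dvdn_divisors// => dn /= rd.
suff /eqP <- : d == n by [].
rewrite eqn_dvd dn (prim_order_dvd zP) -subr_eq0.
have d0 := dvdn_gt0 n0 dn.
have -> : z ^+ d - 1 = (pZto F ('X^d - 1)).[z].
  by rewrite rmorphB rmorph1 /= map_polyXn !hornerE.
rewrite -prod_Cyclotomic// (big_rem d)/= -?dvdn_divisors//.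
by rewrite rmorphM /= hornerM (eqP rd) mul0r.
Qed.

(** ['Phi_n] is irreducible over the rationals, being the minimal polynomial of a root of unity [w]
    in [algC]. A gcd of rational polynomials does not depend on the field, so a common root [z] in
    [F] makes it nonconstant. *)
Lemma Cyclotomic_dvdp (F : numFieldType) n (z : F) (P : {poly int}) :
  n.-primitive_root z -> root (pZto F P) z -> 'Phi_n %| P.
Proof.
move=> zP rP; have [w wP] := C_prim_root_exists (prim_order_gt0 zP).
have [m [mE _ mP]] := minCpolyP w.
have ratrZ (K : numFieldType) (q : {poly int}) :
    map_poly (ratr : rat -> K) (pZto rat q) = pZto K q.
  by rewrite -map_poly_comp; apply: eq_map_poly => k /=; rewrite ratr_int.
have {mE} mE : m = pZto rat 'Phi_n.
  apply: (map_inj_poly (fmorph_inj (@ratr algC))); first exact: rmorph0.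
  by rewrite ratrZ (Cintr_Cyclotomic wP) -mE (minCpoly_cyclotomic wP).
set g := gcdp m (pZto rat P).
rewrite -dvdp_rat_int -mE; apply: dvdp_trans (dvdp_gcdr m _).
have mw : root (map_poly ratr m) w by rewrite mP.
have := dvdp_gcdl m (pZto rat P); rewrite -/g => /dvdpP[h hE].
(* As m is the minimal polynomial of w, either m divides g, or m divides h and g
   is constant; the latter is excluded because g vanishes at z. *)
have /orP[mh|//] : (m %| h) || (m %| g) by rewrite -!mP -rootM -rmorphM -hE.
have m0 : m != 0.
  by rewrite mE map_poly_eq0_id0 ?intr_eq0 ?lead_coef_eq0// monic_neq0//
             Cyclotomic_monic.
have h0 : h != 0 by apply: contra_neq m0 => h0; rewrite hE h0 mul0r.
have g0 : g != 0 by apply: contra_neq m0 => g0; rewrite hE g0 mulr0.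
have rg : root (map_poly (ratr : rat -> F) g) z.
  by rewrite gcdp_map root_gcd mE !ratrZ root_Cyclotomic.
have := root_size_gt1 _ rg; rewrite map_poly_eq0 size_map_poly => /(_ g0) sg.
have := dvdp_leq h0 mh; rewrite hE size_mul//.
by rewrite -(subnKC sg) addSn addnS /= addnS leqNgt ltnS leq_addr.
Qed.

(** If r is the valuation, a - b = m p^r with p not dividing m, so the quotients of a and b by p^r
    differ by m. *)
Lemma digit_logn_sub_neq p a b : prime p -> (b < a)%N ->
  ((a %/ p ^ logn p (a - b)) %% p <> (b %/ p ^ logn p (a - b)) %% p)%N.
Proof.
move=> pP ba; set r := logn p (a - b).
have [//|m pm] := pfactor_coprime pP (_ : 0 < a - b)%N; first by rewrite subn_gt0.
rewrite -/r => abE.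
have -> : a = (m * p ^ r + b)%N by rewrite -abE subnK// ltnW.
rewrite divnMDl ?expn_gt0 ?prime_gt0// -{2}[(b %/ _)%N]add0n => /eqP.
rewrite eqn_modDr mod0n -/(dvdn p m) => pdm.
by move: pm; rewrite prime_coprime// pdm.
Qed.

(** * Complex exponentials *)

Section Exponential.
Local Open Scope complex_scope.
Context {R : realType}.
Implicit Types a b x y : R.

Lemma expfunD a x y : expfun a (x + y) = expfun a x * expfun a y.
Proof. by rewrite /expfun mulrDr cosD sinD; congr (_ +i* _); rewrite addrC. Qed.

Lemma expfunE a x : expfun a x = expfun 1 (a * x).
Proof. by rewrite /expfun mulr1 !mulrA. Qed.

Lemma expfun0r a : expfun a 0 = 1.
Proof. by rewrite /expfun mulr0 cos0 sin0. Qed.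

Lemma expfunMn a x n : expfun a (n%:R * x) = expfun a x ^+ n.
Proof.
elim: n => [|n IHn]; first by rewrite mul0r expfun0r.
by rewrite exprS -IHn -expfunD -{2}[x]mul1r -mulrDl nat1r.
Qed.

Lemma expfunB a b x : expfun a x * (expfun b x)^* = expfun (a - b) x.
Proof.
rewrite /expfun !(mulrBr, mulrBl) cosB sinB /=.
by congr (_ +i* _); ring.
Qed.

Lemma expfun11 : expfun 1 1 = 1 :> R[i].
Proof. by rewrite /expfun !mulr1 mulr_natl cos2pi sin2pi. Qed.

Lemma expfun_neq1 x : 0 < x < 1 -> expfun 1 x != 1.
Proof.
move=> /andP[x0 x1]; apply/eqP => -[+ _].
have -> : 2 * pi * 1 * x = pi * x + pi * x :> R by ring.
(* cos 2u = 1 - 2 sin^2 u equals 1 only if sin u = 0, whereas u = pi x lies strictly between 0 and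
   pi. *)
rewrite cosD -!expr2 cos2sin2 => e.
have : 0 < sin (pi * x).
  by apply: sin_gt0_pi; rewrite mulr_gt0 ?pi_gt0//= gtr_pMr ?pi_gt0.
by move=> /(exprn_gt0 2); nra.
Qed.

Lemma expfun_prim_root n : (0 < n)%N -> n.-primitive_root (expfun 1 (n%:R^-1 : R)).
Proof.
move=> n0; have n0R : n%:R != 0 :> R by rewrite pnatr_eq0 -lt0n.
apply/andP; split=> //; apply/forallP => i; apply/eqP.
rewrite unity_rootE -expfunMn; case: (eqVneq i.+1 n) => [->|ni].
  by rewrite divff// expfun11 eqxx.
apply/negbTE/expfun_neq1; rewrite divr_gt0 ?ltr0n//= ltr_pdivrMr ?ltr0n//.
by rewrite mul1r ltr_nat ltn_neqAle ni ltn_ord.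
Qed.

Lemma continuous_Re_expfun a : continuous (fun x => complex.Re (expfun a x)).
Proof.
move=> x; apply: continuous_comp; last exact: continuous_cos.
exact: mulrl_continuous.
Qed.

Lemma continuous_Im_expfun a : continuous (fun x => complex.Im (expfun a x)).
Proof.
move=> x; apply: continuous_comp; last exact: continuous_sin.
exact: mulrl_continuous.
Qed.

Lemma normr_Re_expfun a x : `|complex.Re (expfun a x : R[i])| <= 1.
Proof. exact: cos_max. Qed.

Lemma normr_Im_expfun a x : `|complex.Im (expfun a x : R[i])| <= 1.
Proof. exact: sin_max. Qed.

Lemma measurable_Re_expfun a :
  measurable_fun [set: R] (fun x => complex.Re (expfun a x)).
Proof. by apply: continuous_measurable_fun; exact: continuous_Re_expfun. Qed.

Lemma measurable_Im_expfun a :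
  measurable_fun [set: R] (fun x => complex.Im (expfun a x)).
Proof. by apply: continuous_measurable_fun; exact: continuous_Im_expfun. Qed.

End Exponential.

(** * Integrals against a self-similar measure *)

Section SelfSimilarity.
Local Open Scope complex_scope.
Context {R : realType} (N : nat) (D : {fset nat}).
Variable mu : probability (measurableTypeR R) R.

(* MathComp-Analysis has another [contraction], hence the qualified name. *)
Lemma measurable_contraction d :
  measurable_fun [set: R] (Defs.contraction N d : R -> R).
Proof. by apply: measurable_funM => //; exact: measurable_funD. Qed.

Let bounded_integrable (f : R -> R) : measurable_fun [set: R] f ->
  (forall x, `|f x| <= 1) -> mu.-integrable setT (EFin \o f).
Proof.
move=> mf f1; apply: measurable_bounded_integrable => //.
  by apply: le_lt_trans (probability_le1 mu measurableT) (ltry _).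
by exists 1; split=> // M M1 x _; apply: le_trans (f1 x) (ltW M1).
Qed.

Hypothesis muP : cantor_measure N D mu.

(** The hypothesis on [mu] makes it the average of its pushforwards by the contractions; a change of
    variables in each pushforward concludes. *)
Lemma cantor_ge0_integral (f : R -> \bar R) : measurable_fun [set: R] f ->
  (forall x, 0 <= f x)%E ->
  (\int[mu]_x f x =
    ((#|` D|%:R)^-1)%:E * \sum_(d <- D) \int[mu]_x f (Defs.contraction N d x))%E.
Proof.
move=> mf f0.
have c0 : 0 <= (#|` D|%:R)^-1 :> R by rewrite invr_ge0.
pose phi i : measurableTypeR R -> measurableTypeR R :=
  Defs.contraction N (nth 0%N D i).
have mphi i : measurable_fun setT (phi i) := @measurable_contraction _.
pose m_ i : {measure set (measurableTypeR R) -> \bar R} :=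
  pushforward mu (phi i).
rewrite (@eq_measure_integral _ _ _ _ (mscale (NngNum c0) (msum (m_ mphi) #|` D|))).
  rewrite ge0_integral_mscale// ge0_integral_measure_sum//.
  congr (_ * _)%E; rewrite (big_nth 0%N) big_mkord.
  by apply: eq_bigr => i _; rewrite ge0_integral_pushforward.
move=> A mA _; move: (muP mA); rewrite /mscale /msum /= => ->.
by rewrite (big_nth 0%N) big_mkord.
Qed.

Hypothesis D0 : D != fset0.

Lemma cantor_Rintegral (f : R -> R) : measurable_fun [set: R] f ->
  (forall x, `|f x| <= 1) ->
  \int[mu]_x f x =
    (#|` D|%:R)^-1 * \sum_(d <- D) \int[mu]_x f (Defs.contraction N d x).
Proof.
move=> mf f1; have nD0 : #|` D|%:R != 0 :> R by rewrite pnatr_eq0 cardfs_eq0.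
(* Reduces the claim to the nonnegative function 1 + f. *)
have shift (g : R -> R) : measurable_fun [set: R] g -> (forall x, `|g x| <= 1) ->
    (\int[mu]_x (1 + g x)%:E = (1 + \int[mu]_x g x)%:E)%E.
  move=> mg g1; have ig := bounded_integrable mg g1.
  have i1 : mu.-integrable setT (EFin \o (cst 1 : R -> R)).
    by apply: bounded_integrable => // x; rewrite normr1.
  have i1g : mu.-integrable setT (EFin \o (fun x => 1 + g x)).
    exact: (integrableD measurableT i1 ig).
  rewrite -[LHS]fineK ?integrable_fin_num//; congr EFin.
  transitivity (\int[mu]_x (cst 1 x) + \int[mu]_x g x); first exact: RintegralD.
  have /= -> := Rintegral_cst mu measurableT 1.
  by have /= -> := @probability_setT _ _ _ mu; rewrite mulr1.
have mfd d : measurable_fun [set: R] (f \o Defs.contraction N d).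
  exact: measurableT_comp (measurable_contraction d).
have mf' : measurable_fun [set: R] (fun x => (1 + f x)%:E).
  by apply/measurable_EFinP; exact: measurable_funD.
have f0 x : (0 <= (1 + f x)%:E)%E.
  by rewrite lee_fin; have := f1 x; rewrite ler_norml; lra.
have := cantor_ge0_integral mf' f0; rewrite shift//.
rewrite (eq_bigr (fun d => (1 + \int[mu]_x f (Defs.contraction N d x))%:E)).
  rewrite sumEFin -EFinM big_split/= big_const_seq count_predT iter_addr_0.
  by rewrite mulrDr mulVf// => -[] /addrI.
by move=> d _; apply: shift => [|x]; [exact: mfd|exact: f1].
Qed.

Lemma integrable_Re_expfun a :
  mu.-integrable setT (EFin \o (fun x => complex.Re (expfun a x))).
Proof.
exact: bounded_integrable (@measurable_Re_expfun _ a) (normr_Re_expfun a).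
Qed.

Lemma integrable_Im_expfun a :
  mu.-integrable setT (EFin \o (fun x => complex.Im (expfun a x))).
Proof.
exact: bounded_integrable (@measurable_Im_expfun _ a) (normr_Im_expfun a).
Qed.

Lemma Cintegral_expfunZl (c : R[i]) a :
  Cintegral mu (fun x => c * expfun a x) = c * Cintegral mu (expfun a).
Proof.
case: c => u v; have iRe := integrable_Re_expfun a.
have iIm := integrable_Im_expfun a.
have intZ k g : mu.-integrable setT (EFin \o g) ->
    mu.-integrable setT (EFin \o (fun x => k * g x)).
  by move=> ig; apply: (integrableZl measurableT k ig).
rewrite /Cintegral /=; congr (_ +i* _).
  by rewrite RintegralB ?RintegralZl//; exact: intZ.
by rewrite RintegralD ?RintegralZl//; exact: intZ.
Qed.

(** At the image of x under the contraction of index d, e_a equals e(a/N)^d e_{a/N}(x); summing over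
    d produces P_D(e(a/N)). *)
Lemma Cintegral_expfun_selfsimilar (a : R) :
  Cintegral mu (expfun a) =
    (#|` D|%:R)^-1 * (map_poly intr (mask_poly D)).[expfun 1 (a / N%:R)] *
    Cintegral mu (expfun (a / N%:R)).
Proof.
have sumE : (map_poly intr (mask_poly D)).[expfun 1 (a / N%:R)] *
    Cintegral mu (expfun (a / N%:R)) =
    \sum_(d <- D) Cintegral mu (fun x => expfun a (Defs.contraction N d x)).
  rewrite rmorph_sum horner_sum mulr_suml; apply: eq_bigr => d _.
  rewrite /= map_polyXn hornerXn -expfunMn -Cintegral_expfunZl.
  congr Cintegral; apply/funext => x.
  by rewrite !(expfunE _ x) !(expfunE a) -expfunD; congr expfun;
    rewrite /Defs.contraction; ring.
(* 1/|D| is real, so it commutes with real and imaginary parts, to which [cantor_Rintegral] applies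
   separately. *)
have reE k (z : R[i]) : complex.Re (k%:C * z) = k * complex.Re z.
  by case: z => u v; rewrite /= mul0r subr0.
have imE k (z : R[i]) : complex.Im (k%:C * z) = k * complex.Im z.
  by case: z => u v; rewrite /= mul0r addr0.
rewrite -mulrA sumE (_ : _^-1 = ((#|` D|%:R)^-1)%:C); last first.
  by rewrite fmorphV rmorph_nat.
apply/eqP; rewrite eq_complex reE imE !raddf_sum /=.
have /= -> := cantor_Rintegral (@measurable_Re_expfun _ a) (normr_Re_expfun a).
have /= -> := cantor_Rintegral (@measurable_Im_expfun _ a) (normr_Im_expfun a).
by rewrite !eqxx.
Qed.

Lemma Cintegral_expfun_eq0 (a : R) : (1 < N)%N ->
  Cintegral mu (expfun a) = 0 ->
  exists k, (0 < k)%N /\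
    root (map_poly intr (mask_poly D)) (expfun 1 (a / (N ^ k)%:R)).
Proof.
move=> N1 Fa0; apply: contrapT => /forallNP nroot.
have nD0 : #|` D|%:R != 0 :> R[i] by rewrite pnatr_eq0 cardfs_eq0.
(* By [nroot] no factor P_D(e(a/N^(k+1))) vanishes, so the zero at a propagates to every a/N^k. *)
have F0 k : Cintegral mu (expfun (a / (N ^ k)%:R)) = 0.
  elim: k => [|k IHk]; first by rewrite divr1.
  have := Cintegral_expfun_selfsimilar (a / (N ^ k)%:R).
  rewrite IHk -[a / _ / _]mulrA -invfM -natrM -expnSr => /esym/eqP.
  rewrite !mulf_eq0 invr_eq0 (negPf nD0)/= => /orP[rk|/eqP//].
  by case: (nroot k.+1).
have cvg0 : (a / (N ^ k)%:R @[k --> \oo] --> (0 : R)).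
  rewrite -[X in _ --> X](mulr0 a); apply: cvgM; first exact: cvg_cst.
  under eq_cvg do rewrite natrX -exprVn.
  apply: cvg_expr; rewrite ger0_norm ?invr_ge0//.
  by rewrite invf_lt1 ?ltr1n// ltr0n ltnW.
(* The real parts alone contradict [F0]: they are dominated by 1 and tend pointwise to 1. *)
have cvg1 : (\int[mu]_x (complex.Re (expfun (a / (N ^ k)%:R) x))%:E @[k --> \oo] -->
    \int[mu]_x (cst 1 x)%:E)%E.
  apply: (@dominated_cvg _ _ _ mu setT measurableT _ _ (cst 1%E)).
  - move=> k; apply/measurable_EFinP.
    exact: (@measurable_Re_expfun _ (a / (N ^ k)%:R)).
  - move=> x _; apply: cvg_EFin; first exact: nearW.
    (* Exchanging frequency and point turns the limit at frequency 0 into continuity of [expfun x]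
       at 0. *)
    rewrite [X in _ --> X](_ : _ = complex.Re (expfun x (0 : R))).
      2: by rewrite expfun0r.
    apply: (@cvg_trans _ ((fun k => complex.Re (expfun x (a / (N ^ k)%:R))) @ \oo)).
      apply: near_eq_cvg; apply: nearW => k /=.
      by rewrite /expfun /= mulrAC.
    exact: (cvg_comp _ _ cvg0 (@continuous_Re_expfun _ x 0)).
  - by [].
  - by apply: bounded_integrable => // x; rewrite normr1.
  - by move=> k x _; rewrite lee_fin; exact: normr_Re_expfun.
have int1 : (\int[mu]_x (cst 1 x)%:E = 1)%E.
  have /= -> := integral_cst mu measurableT 1.
  by rewrite mul1e; exact: probability_setT.
have int0 k : (\int[mu]_x (complex.Re (expfun (a / (N ^ k)%:R) x))%:E = 0)%E.
  rewrite -[LHS]fineK; last exact/integrable_fin_num/integrable_Re_expfun.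
  by congr EFin; have [] := F0 k.
have /eqP : (0 = 1 :> \bar R)%E.
  rewrite -int1 -(cvg_lim (@ereal_hausdorff R) cvg1).
  by apply/esym/lim_near_cst => //; apply: nearW => k; exact: int0.
by rewrite eq_sym onee_eq0.
Qed.

End SelfSimilarity.

(** * Valuations of differences of frequencies *)

Lemma Cintegral_expfun_nat_eq0 (R : realType) p alpha (D : {fset nat})
    (mu : probability (measurableTypeR R) R) m :
  prime p -> (0 < alpha)%N -> D != fset0 -> cantor_measure (p ^ alpha) D mu ->
  (0 < m)%N -> Cintegral mu (expfun m%:R) = 0 ->
  exists k, exists2 t, cyclotomic_exponents p D t & (logn p m + t = alpha * k)%N.
Proof.
move=> pP a0 D0 muP m0 /(Cintegral_expfun_eq0 muP D0).
rewrite -(expn0 p) ltn_exp2l ?prime_gt1// => /(_ a0)[k [k0]].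
rewrite -expnM; set e := (alpha * k)%N.
have pe0 : (0 < p ^ e)%N by rewrite expn_gt0 prime_gt0.
have := exp_prim_root (expfun_prim_root (R := R) pe0) m; rewrite -expfunMn.
(* e(m/p^e) is the m-th power of a primitive root of order p^e, so its order is p^e / gcd(m, p^e) =
   p^(e-f). *)
have [f fe gE] : exists2 f, (f <= e)%N & gcdn m (p ^ e) = (p ^ f)%N.
  by apply/(dvdn_pfactor _ _ pP); exact: dvdn_gcdr.
rewrite gE -expnB ?prime_gt0//; set z := expfun 1 _ => zP rz.
(* If f = e then z = 1, but P_D(1) = |D| is nonzero. *)
have f_lt_e : (f < e)%N.
  rewrite ltn_neqAle fe andbT; apply/eqP => fE; move: zP rz.
  rewrite fE subnn expn0 => /prim_expr_order; rewrite expr1 => ->.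
  rewrite rootE rmorph_sum horner_sum.
  under eq_bigr do rewrite /= map_polyXn hornerXn expr1n.
  by rewrite big_const_seq count_predT iter_addr_0 pnatr_eq0 cardfs_eq0 (negPf D0).
exists k, (e - f)%N; first by split; [rewrite subn_gt0|exact: Cyclotomic_dvdp zP rz].
suff -> : logn p m = f by rewrite subnKC// ltnW.
(* As f < e, p^(f+1) divides p^e but not the gcd, hence not m; so f is the full valuation of m. *)
have dvdE j : (p ^ j %| p ^ f)%N = (p ^ j %| m)%N && (p ^ j %| p ^ e)%N.
  by rewrite -gE dvdn_gcd.
apply/eqP; rewrite eqn_leq; apply/andP; split.
  rewrite leqNgt; apply/negP => fm.
  have := dvdE f.+1; rewrite (pfactor_dvdn f.+1 pP m0) fm (dvdn_exp2l _ f_lt_e).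
  by rewrite dvdn_Pexp2l ?prime_gt1// ltnn.
have := dvdE f; rewrite dvdnn => /esym/andP[+ _].
by rewrite pfactor_dvdn.
Qed.

Lemma orthogonal_logn_sub (R : realType) p alpha (D : {fset nat})
    (mu : probability (measurableTypeR R) R) (Lam : set int) l l' :
  prime p -> (0 < alpha)%N -> D != fset0 -> cantor_measure (p ^ alpha) D mu ->
  orthogonal_exponentials mu Lam -> Lam l -> Lam l' -> l != l' ->
  exists k, exists2 t, cyclotomic_exponents p D t &
    (logn p `|l - l'| + t = alpha * k)%N.
Proof.
move=> pP a0 D0 muP orth.
(* By symmetry the difference may be taken positive, hence a natural frequency. *)
wlog l'l : l l' / l' < l => [wl|] Ll Ll' ll'.
  have [l'l|ll|] := ltgtP l' l; last by move=> e; rewrite e eqxx in ll'.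
    exact: wl.
  by rewrite distnC; apply: wl => //; rewrite eq_sym.
have m0 : (0 < `|l - l'|)%N by rewrite absz_gt0 subr_eq0.
apply: (Cintegral_expfun_nat_eq0 pP a0 D0 muP m0).
rewrite -(orth l l' Ll Ll' ll'); congr Cintegral; apply/funext => x.
by rewrite expfunB -intrB -[in RHS](@gez0_abs (l - l')) ?subr_ge0 ?ltW.
Qed.

(** * From equal initial digits to valuations *)

Lemma digit_tail_sub N n l l' :
  (forall j, (j < n)%N -> digit N j l = digit N j l') ->
  l - l' = (N ^ n)%:Z * (digit_tail N l n - digit_tail N l' n).
Proof.
elim: n => [|n IHn] dE; first by rewrite mul1r.
rewrite IHn => [|j jn]; last by rewrite dE// ltnW.
by rewrite (digit_tailE N l) (digit_tailE N l') dE// expnSr PoszM; ring.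
Qed.

(** The difference is N^n x with x = (a - b) + N (c - c'). Since 0 < a - b < N, the valuation of a -
    b is below alpha, and the multiple of N does not alter it. *)
Lemma logn_digit_sub p alpha n l l' (N := (p ^ alpha)%N) :
  prime p -> (forall j, (j < n)%N -> digit N j l = digit N j l') ->
  (`|digit N n l'| < `|digit N n l|)%N ->
  let r := logn p (`|digit N n l| - `|digit N n l'|) in
  (r < alpha)%N /\ logn p `|l - l'| = (n * alpha + r)%N.
Proof.
move=> pP dE; have N0 : (0 < N)%N by rewrite expn_gt0 prime_gt0.
have /andP[a0 aN] := digit_bounds n l N0.
have /andP[b0 _] := digit_bounds n l' N0.
have := digit_tail_sub dE; rewrite (digit_tailE N l) (digit_tailE N l').
rewrite -(gez0_abs a0) in aN *; rewrite -(gez0_abs b0).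
set a := `|digit N n l|%N in aN *; set b := `|digit N n l'|%N.
set c := digit_tail N l _; set c' := digit_tail N l' _ => lE ba /=.
set r := logn p (a - b).
have ab0 : (0 < a - b)%N by rewrite subn_gt0.
have r_lt : (r < alpha)%N.
  rewrite -(ltn_exp2l _ _ (prime_gt1 pP)).
  apply: leq_ltn_trans (dvdn_leq ab0 (pfactor_dvdnn p _)) _.
  by apply: leq_ltn_trans (leq_subr _ _) _.
split=> //; set x := (a - b)%N%:Z + N%:Z * (c - c').
have {}lE : l - l' = (N ^ n)%:Z * x.
  by rewrite lE /x -subzn ?(ltnW ba)//; ring.
have dvdx j : (j <= alpha)%N -> (p ^ j %| `|x|)%N = (p ^ j %| a - b)%N.
  move=> ja; rewrite -[LHS]/((p ^ j)%:Z %| x)%Z rpredDr//.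
  by apply: dvdz_mulr; rewrite /= dvdzE /= dvdn_exp2l.
(* Were x zero, p^alpha would divide a - b, which lies strictly between 0 and p^alpha. *)
have x0 : (0 < `|x|)%N.
  rewrite lt0n; apply/eqP => x0; have := dvdx alpha (leqnn _).
  rewrite x0 dvdn0 => /esym/(dvdn_leq ab0); rewrite leqNgt.
  by rewrite (leq_ltn_trans (leq_subr _ _) aN).
have Nn0 : (0 < N ^ n)%N by rewrite expn_gt0 N0.
rewrite lE abszM (absz_nat (N ^ n)) lognM// lognX pfactorK//.
congr addn; apply/eqP; rewrite eqn_leq; apply/andP; split.
  by rewrite leqNgt -pfactor_dvdn// dvdx// pfactor_dvdn// ltnn.
by rewrite -pfactor_dvdn// dvdx ?pfactor_dvdnn// ltnW.
Qed.

(** * Counting the possible digits *)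

Theorem theorem3p1 (R : realType) (p alpha N : nat) (D : {fset nat})
    (mu : probability (measurableTypeR R) R) (Lam : set int) :
  prime p -> (1 <= alpha)%N -> N = (p ^ alpha)%N ->
  D != fset0 ->
  {in D &, forall d d' : nat, d != d' -> d <> d' %[mod N]} ->
  cantor_measure N D mu ->
  orthogonal_exponentials mu Lam ->
  forall (n : nat) (d : 'I_n -> int),
    (forall j : 'I_n, 0 <= d j < N%:Z) ->
    (#|` fset_set [set digit N n l | l in digit_cylinder N Lam d] |
      <= p ^ #|` fset_set (cyclotomic_exponents p D) |)%N.
Proof.
move=> pP a0 NE D0 _ muP orth n d _; rewrite {N}NE in muP *; set N := (p ^ alpha)%N.
have N0 : (0 < N)%N by rewrite expn_gt0 prime_gt0.
set S := fset_set _; set T := fset_set (cyclotomic_exponents p D).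
(* Each t in T points at the base-p digit of rank - t mod alpha; the n-th
   digits in base N are determined by these |T| base-p digits. *)
pose res t := ((alpha * t - t) %% alpha)%N.
pose h (a : S) : {ffun T -> 'I_p} := [ffun t =>
  Ordinal (ltn_pmod (`|val a| %/ p ^ res (val t))%N (prime_gt0 pP))].
suff h_inj : injective h.
  by have := leq_card h h_inj; rewrite card_ffun card_ord !cardfE.
have memS (a : S) : exists2 l, digit_cylinder N Lam d l & digit N n l = val a.
  have := valP a; rewrite in_fset_set; last exact: finite_digits.
  by rewrite inE => -[l ? ?]; exists l.
move=> a b hE; apply/val_inj/eqP; apply: contraT.
(* Digits are nonnegative, so comparing absolute values compares the digits themselves. *)
wlog ba : a b hE / (`|val b| < `|val a|)%N => [wl ab|].
  have [ba|ab'|e] := ltngtP `|val b|%N `|val a|%N.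
  - exact: (wl a b).
  - by apply: (wl b a); rewrite // eq_sym.
  have [l _ al] := memS a; have [l' _ bl] := memS b.
  have /andP[+ _] := digit_bounds n l N0; have /andP[+ _] := digit_bounds n l' N0.
  by rewrite al bl => /gez0_abs b0 /gez0_abs a0'; rewrite -b0 -a0' e eqxx in ab.
have [l [Ll ld] al] := memS a; have [l' [Ll' ld'] bl] := memS b.
rewrite -al -bl in ba * => _.
have dE j : (j < n)%N -> digit N j l = digit N j l'.
  by move=> jn; rewrite (ld (Ordinal jn)) (ld' (Ordinal jn)).
have [r_lt lognE] := logn_digit_sub pP dE ba.
have ll' : l != l' by apply: contraTneq ba => ->; rewrite ltnn.
have [k [t tT]] := orthogonal_logn_sub pP a0 D0 muP orth Ll Ll' ll'.
rewrite lognE => tE.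
have tT' : t \in T.
  by rewrite in_fset_set ?inE//; exact: finite_cyclotomic_exponents.
(* From n alpha + r + t = alpha k, r is - t modulo alpha, and r < alpha is its own residue. The
   subtraction in [res] is not truncated because alpha is positive. *)
have rE : res t = logn p (`|digit N n l| - `|digit N n l'|).
  rewrite -[RHS](modn_small r_lt); apply/eqP; rewrite -(eqn_modDr t).
  by rewrite subnK ?leq_pmull// modnMr -(modnMDl n) addnA tE modnMr.
have := congr1 (fun f : {ffun T -> 'I_p} => val (f [` tT']%fset)) hE.
by rewrite !ffunE /= rE -al -bl => /(digit_logn_sub_neq pP ba).
Qed.
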